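(* Let $G=F(\Sigma)$ be the free group with basis $\Sigma$, with $|\Sigma|\ge2$, and let $A=\bigoplus_{i\in\Omega}\langle t_i\rangle$. Assume that $\Omega$ is a limit ordinal, that is, for each $d\in\Omega$ we have $d+1\in\Omega$, too. Then the group $\mathrm{E}(A,G)$ is generated by elements of order $2$.
   Context: Ordered group $A$. $\Omega$ is a set of ordinals with least element $0$; $A=\bigoplus_{i\in\Omega}\langle t_i\rangle$ with each $\langle t_i\rangle\cong\mathbb{Z}$. For $\alpha=\sum_i n_it_i\neq 0$, $\deg(\alpha)$ is the greatest $i$ with $n_i\ne 0$; $\alpha$ is positive if $n_{\deg(\alpha)}>0$; $\alpha\le\beta$ iff $\alpha=\beta$ or $\beta-\alpha$ is positive. $\mathbb{Z}$ is a subgroup of $A$ via $n\mapsto nt_0$, so $1=t_0$ is the least positive element. Words. $\Gamma=\Sigma\cup\Sigma^{-1}\subseteq G$, $\overline a=a^{-1}$ for $a\in\Gamma$, and $\pi:\Gamma^*\to G$ is the induced monoid homomorphism. A (closed) $A$-word of length $\alpha\ge 0$ is a map $p:[1,\alpha]\to\Gamma$, where $[1,\alpha]=\{\beta\in A: 1\le\beta\le\alpha\}$; $|p|=\alpha$. $W(A,\Gamma)$ is the monoid of $A$-words under concatenation: $(p\cdot q)(\beta)=p(\beta)$ for $1\le\beta\le|p|$ and $(p\cdot q)(\beta)=q(\beta-|p|)$ for $|p|<\beta\le|p|+|q|$. The involution is $\overline p(\beta)=\overline{p(|p|+1-\beta)}$. A word is finite if $|p|\in\mathbb{N}$; finite words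 are identified with elements of $\Gamma^*$. A word $x$ is $G$-reduced if no non-empty finite factor of $x$ (a finite $f\ne1$ with $x=pfq$) equals $1$ in $G$ under $\pi$. $R(A,G)$ is the set of $G$-reduced words and $R^*(A,G)$ the submonoid of $W(A,\Gamma)$ generated by $R(A,G)$. The group $\mathrm{E}(A,G)$. $\mathcal{M}(A,G)$ is the quotient monoid of $W(A,\Gamma)$ by the relations $u\,\ell\,\overline{r}\,\overline{u}=1$ for all $u\in R(A,G)$ and $\ell,r\in\Gamma^*$ with $\pi(\ell)=\pi(r)$. $\mathrm{E}(A,G)$ is the image of $R^*(A,G)$ in $\mathcal{M}(A,G)$; it is a group, and the inverse of the class of $u\in R(A,G)$ is the class of $\overline u$. *)

(* Defs.v *)
(* MathComp, with the classical axioms of mathcomp.classical.boolp. *)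
From HB Require Import structures.
From mathcomp Require Import all_boot all_order all_algebra.
From mathcomp Require Import boolp wochoice.
From mathcomp Require Import freeg.

Set Implicit Arguments.
Unset Strict Implicit.
Unset Printing Implicit Defensive.

Import Order.TTheory GRing.Theory Num.Theory.

Local Open Scope ring_scope.

(* Only the order type of a set of ordinals matters, so a set Omega of
   ordinals with least element 0 is a type [Omega : bOrderType d] whose order
   is a [well_order]; \bot is the ordinal 0, and j is i + 1 when j is the least
   element of Omega above i. *)
Definition is_succ (d : Order.disp_t) (Omega : bOrderType d) (i j : Omega) :=
  (i < j)%O /\ forall k : Omega, (i < k)%O -> (j <= k)%O.

(* -------------------------------------------------------------------- *)
Section DirectSum.

Variables (d : Order.disp_t) (Omega : bOrderType d).

Definition dsum := {freeg Omega / int}.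

HB.instance Definition _ := GRing.Zmodule.on dsum.

Implicit Types (a b c : dsum) (i j k : Omega).

Definition tgen i : dsum := << i >>.

(* deg in the mathematics; freeg.deg is the sum of the coefficients. *)
Definition lead a : Omega := \big[Order.max / \bot%O]_(i <- dom a) i.

Definition positive a := (a != 0) && (0 < coeff (lead a) a).

Definition dsum_le a b := (a == b) || positive (b - a).

Lemma leadP a : a != 0 -> lead a \in dom a.
Proof.
rewrite -dom_eq0 /lead; case: (dom a) => // x s _.
elim: s x => [|y s IHs] x; first by rewrite big_cons big_nil (max_idPl (le0x _)) mem_head.
rewrite big_cons; case: (leP x (\big[Order.max / \bot%O]_(j <- y :: s) j)) => _.
  by rewrite inE IHs orbT.
by rewrite mem_head.
Qed.

Lemma lead_ge a i : i \in dom a -> (i <= lead a)%O.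
Proof.
rewrite /lead; elim: (dom a) => // x s IHs; rewrite inE big_cons le_max.
by case/predU1P=> [->|/IHs ->]; rewrite ?lexx ?orbT.
Qed.

Lemma coeff_gt_lead a i : (lead a < i)%O -> coeff i a = 0.
Proof.
move=> lt_ai; apply: coeff_outdom; apply: contraTN lt_ai => /lead_ge.
by rewrite leNgt.
Qed.

Lemma positiveP a :
  reflect (exists2 i, 0 < coeff i a & forall k, (i < k)%O -> coeff k a = 0)
          (positive a).
Proof.
apply: (iffP andP) => [[_ a_gt0]|[i ai_gt0 ai0]].
  by exists (lead a) => // k; apply: coeff_gt_lead.
have nz_a : a != 0 by apply: contraTneq ai_gt0 => ->; rewrite coeff0.
split=> //; suff -> : lead a = i by [].
apply/eqP; rewrite eq_le lead_ge ?mem_dom ?gt_eqF // andbT leNgt.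
by apply: contraTN (leadP nz_a) => /ai0; rewrite mem_dom => ->; rewrite eqxx.
Qed.

Lemma positive0 : positive 0 = false.
Proof. by rewrite /positive eqxx. Qed.

Lemma positiveD a b : positive a -> positive b -> positive (a + b).
Proof.
move=> /positiveP[i ai ai0] /positiveP[j bj bj0]; apply/positiveP.
case: (ltgtP i j) => [lt_ij|lt_ji|eq_ij].
- exists j => [|k lt_jk]; rewrite coeffD.
    by rewrite (ai0 _ lt_ij) add0r.
  by rewrite bj0 // ai0 ?addr0 // (lt_trans lt_ij).
- exists i => [|k lt_ik]; rewrite coeffD.
    by rewrite (bj0 _ lt_ji) addr0.
  by rewrite ai0 // bj0 ?addr0 // (lt_trans lt_ji).
exists i => [|k lt_ik]; rewrite coeffD; first by rewrite addr_gt0 // eq_ij.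
by rewrite ai0 // bj0 ?addr0 // -eq_ij.
Qed.

Lemma positive_total a : [|| a == 0, positive a | positive (- a)].
Proof.
case: eqP => //= /eqP nz_a.
have : coeff (lead a) a != 0 by rewrite -mem_dom leadP.
case: (ltgtP (coeff (lead a) a) 0) => // a_lead _; apply/orP.
- right; apply/positiveP; exists (lead a) => [|k /coeff_gt_lead ak0].
    by rewrite coeffN oppr_gt0.
  by rewrite coeffN ak0 oppr0.
- by left; apply/positiveP; exists (lead a) => // k /coeff_gt_lead.
Qed.

Fact dsum_le_refl : reflexive dsum_le.
Proof. by move=> a; rewrite /dsum_le eqxx. Qed.

Fact dsum_le_anti : antisymmetric dsum_le.
Proof.
move=> a b; rewrite /dsum_le; case: eqP => //= _ /andP[pos_ba].
case: eqP => //= _ pos_ab.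
by have := positiveD pos_ba pos_ab; rewrite addrA subrK subrr positive0.
Qed.

Fact dsum_le_trans : transitive dsum_le.
Proof.
rewrite /dsum_le => b a c /predU1P[->//|pos_ba] /predU1P[<-|pos_cb].
  by rewrite pos_ba orbT.
have := positiveD pos_cb pos_ba.
by rewrite addrA subrK => ->; rewrite orbT.
Qed.

HB.instance Definition _ :=
  Order.Le_isPOrder.Build ring_display dsum
    dsum_le_refl dsum_le_anti dsum_le_trans.

Fact dsum_le_total : total (<=%O : rel dsum).
Proof.
move=> a b; rewrite /Order.le /= /dsum_le [b == a]eq_sym.
have := positive_total (b - a).
rewrite opprB subr_eq0 [b == a]eq_sym.
by case: (a == b) => //=.
Qed.

HB.instance Definition _ :=
  Order.POrder_isTotal.Build ring_display dsum dsum_le_total.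

(* The unit 1 of the subgroup Z of A *)
Definition t0 : dsum := tgen \bot%O.

Lemma dsum_leE a b : (a <= b) = (a == b) || positive (b - a).
Proof. by []. Qed.

Lemma dsum_ltE a b : (a < b) = positive (b - a).
Proof.
rewrite lt_def dsum_leE; case: (eqVneq a b) => [->|neq_ab] /=.
  by rewrite subrr positive0.
by [].
Qed.

Lemma dsum_gt0 a : (0 < a) = positive a.
Proof. by rewrite dsum_ltE subr0. Qed.

Lemma dsum_leD2r c a b : (a + c <= b + c) = (a <= b).
Proof. by rewrite !dsum_leE (inj_eq (addIr c)) opprD addrACA subrr addr0. Qed.

Lemma dsum_ltD2r c a b : (a + c < b + c) = (a < b).
Proof. by rewrite !dsum_ltE opprD addrACA subrr addr0. Qed.

Lemma dsum_subr_ge0 a b : (0 <= a - b) = (b <= a).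
Proof. by rewrite -[LHS](dsum_leD2r b) add0r subrK. Qed.

Lemma dsum_reflect_le a b c : (a + c - b <= a) = (c <= b).
Proof.
rewrite -[LHS]dsum_subr_ge0 -[RHS]dsum_subr_ge0; congr (_ <= _).
by rewrite opprB opprD addrCA addNKr.
Qed.

Lemma dsum_reflect_ge a b c : (c <= a + c - b) = (b <= a).
Proof.
rewrite -[LHS]dsum_subr_ge0 -[RHS]dsum_subr_ge0; congr (_ <= _).
by rewrite addrAC addrK.
Qed.

Lemma t0_gt0 : 0 < t0.
Proof.
rewrite dsum_gt0; apply/positiveP; exists \bot%O => [|k k_gt].
  by rewrite coeffU eqxx.
by rewrite coeffU lt_eqF // mulr0.
Qed.

Lemma t0_le a : (t0 <= a) = (0 < a).
Proof.
apply/idP/idP => [|a_gt0]; first exact: lt_le_trans t0_gt0.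
rewrite leNgt; apply/negP; rewrite dsum_ltE.
move: a_gt0; rewrite dsum_gt0 => /positiveP[i ai ai0] /positiveP[j].
have coeff_t0 k : (\bot < k)%O -> coeff k t0 = 0.
  by move=> k_gt; rewrite coeffU lt_eqF // mulr0.
rewrite coeffB => aj aj0; case: (ltgtP i j) => [lt_ij|lt_ji|eq_ij].
- have := aj; rewrite (ai0 _ lt_ij) coeff_t0 ?subrr //.
  exact: le_lt_trans (le0x _) lt_ij.
- have := aj0 i lt_ji; rewrite coeffB coeff_t0; last first.
    exact: le_lt_trans (le0x _) lt_ji.
  by rewrite sub0r => /eqP; rewrite oppr_eq0 gt_eqF.
move: aj ai; rewrite -eq_ij; have [->|nz_i] := eqVneq i \bot%O.
  rewrite coeffU eqxx mulr1 subr_gt0.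
  by case: (coeff _ _) => [[|n]|n].
rewrite coeff_t0 ?lt0x // sub0r oppr_gt0 => ai_lt0 ai_gt0.
by have := lt_trans ai_lt0 ai_gt0; rewrite ltxx.
Qed.

Lemma dsum_ltS a b : (a < b) = (a + t0 <= b).
Proof.
by rewrite -[RHS]dsum_subr_ge0 opprD addrA dsum_subr_ge0 t0_le dsum_gt0 dsum_ltE.
Qed.

End DirectSum.

(* -------------------------------------------------------------------- *)
(* Submonoids and subgroups generated by X are intersections of the boolean
   predicates (all predicates, classically) that contain X. *)
Definition submonoid_gen (M : monoidType) (X : M -> Prop) (x : M) : Prop :=
  forall T : {pred M}, monoid_closed T -> (forall y, X y -> y \in T) -> x \in T.

Definition subgroup_gen (G : groupType) (X : G -> Prop) (x : G) : Prop :=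
  forall T : {pred G}, group_closed T -> (forall y, X y -> y \in T) -> x \in T.

Definition generated_by (G : groupType) (X : G -> Prop) : Prop :=
  forall x, subgroup_gen X x.

Definition has_order (G : groupType) (x : G) (n : nat) : Prop :=
  [/\ (0 < n)%N, (x ^+ n)%g = 1%g
    & forall m, (0 < m < n)%N -> (x ^+ m)%g <> 1%g].

Definition free_basis (G : groupType) (Sigma : {pred G}) : Prop :=
  forall (H : groupType) (f : G -> H),
    exists phi : {multiplicative G -> H},
      {in Sigma, phi =1 f} /\
      forall psi : {multiplicative G -> H}, {in Sigma, psi =1 f} -> psi =1 phi.

(* -------------------------------------------------------------------- *)
Section Words.

Variables (d : Order.disp_t) (Omega : bOrderType d).
Variables (G : groupType) (Sigma : {pred G}).

Local Notation A := (dsum Omega).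

(* letter is Gamma, letterV the involution of Gamma, and eval is pi. *)
Definition letter := {g : G | (g \in Sigma) || ((g^-1)%g \in Sigma)}.

Fact letterV_subproof (a : letter) :
  (((val a)^-1)%g \in Sigma) || ((((val a)^-1)^-1)%g \in Sigma).
Proof. by rewrite invgK orbC; exact: valP a. Qed.

Definition letterV (a : letter) : letter :=
  exist (fun g => (g \in Sigma) || ((g^-1)%g \in Sigma)) _ (letterV_subproof a).

Lemma letterVK : involutive letterV.
Proof. by move=> a; apply: val_inj; rewrite /= invgK. Qed.

Definition eval (s : seq letter) : G := (\prod_(a <- s) val a)%g.

(* A map p : [1, alpha] -> Gamma is a partial function on A whose domain is
   exactly [1, alpha]. *)
Record word := Word {
  wlen : A;
  wfun :> A -> option letter;
  wlen_ge0 : 0 <= wlen;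
  wfun_dom : forall b : A, wfun b = (t0 Omega <= b <= wlen) :> bool
}.

HB.instance Definition _ := gen_eqMixin word.
HB.instance Definition _ := gen_choiceMixin word.

Lemma word_ext (p q : word) : wlen p = wlen q -> wfun p =1 wfun q -> p = q.
Proof.
case: p q => [a f a0 fd] [b g b0 gd] /= eq_ab /funext eq_fg.
rewrite -{b}eq_ab -{g}eq_fg in b0 gd *; congr Word; exact: Prop_irrelevance.
Qed.

Lemma wfun_out (p : word) (b : A) : ~~ (t0 Omega <= b <= wlen p) -> p b = None.
Proof. by rewrite -wfun_dom; case: (p b). Qed.

Fact word1_dom (b : A) :
  (None : option letter) = (t0 Omega <= b <= 0) :> bool.
Proof. by rewrite t0_le; apply/esym/negbTE; rewrite negb_and -ltNge; case: ltP. Qed.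

Definition word1 : word := Word (lexx 0) word1_dom.

Fact wcat_ge0 (p q : word) : 0 <= wlen p + wlen q.
Proof.
apply: le_trans (wlen_ge0 q) _.
by rewrite -[leLHS]add0r dsum_leD2r wlen_ge0.
Qed.

Fact wcat_dom (p q : word) (b : A) :
  (if b <= wlen p then p b else q (b - wlen p))
    = (t0 Omega <= b <= wlen p + wlen q) :> bool.
Proof.
case: ifPn => [le_bp|]; rewrite ?wfun_dom.
  rewrite le_bp; congr (_ && _); apply/esym/(le_trans le_bp).
  by rewrite -[leLHS]add0r [leRHS]addrC dsum_leD2r wlen_ge0.
rewrite -ltNge => lt_pb; rewrite !t0_le -(dsum_ltD2r (wlen p)) subrK add0r lt_pb.
rewrite (le_lt_trans (wlen_ge0 p) lt_pb) /=.
by rewrite -(dsum_leD2r (wlen p)) subrK [in RHS]addrC.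
Qed.

Definition wcat (p q : word) : word := Word (wcat_ge0 p q) (wcat_dom p q).

Fact winv_dom (p : word) (b : A) :
  omap letterV (p (wlen p + t0 Omega - b)) = (t0 Omega <= b <= wlen p) :> bool.
Proof.
have -> : omap letterV (p (wlen p + t0 Omega - b))
          = p (wlen p + t0 Omega - b) :> bool by case: (p _).
by rewrite wfun_dom andbC dsum_reflect_le dsum_reflect_ge.
Qed.

Definition winv (p : word) : word := Word (wlen_ge0 p) (winv_dom p).

Fact wcatA : associative wcat.
Proof.
move=> p q r; apply: word_ext => [|b] /=; first by rewrite addrA.
have -> : (b - wlen p <= wlen q) = (b <= wlen p + wlen q).
  by rewrite -[LHS](dsum_leD2r (wlen p)) subrK [wlen q + _]addrC.
case: (leP b (wlen p)) => [le_bp|_]; last by rewrite opprD addrA.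
rewrite ifT //; apply: le_trans le_bp _.
by rewrite -[leLHS]add0r [leRHS]addrC dsum_leD2r wlen_ge0.
Qed.

Fact wcat1w : left_id word1 wcat.
Proof.
move=> p; apply: word_ext => [|b] /=; first by rewrite add0r.
rewrite subr0; case: leP => // le_b0; rewrite wfun_out // negb_and t0_le.
by rewrite -leNgt le_b0.
Qed.

Fact winvK : involutive winv.
Proof.
move=> p; apply: word_ext => //= b.
by rewrite subKr; case: (p b) => //= a; rewrite letterVK.
Qed.

Fact winvM : {morph winv : p q / wcat p q >-> wcat q p}.
Proof.
move=> p q; apply: word_ext => [|b] /=; first by rewrite addrC.
rewrite -[_ + _ + t0 Omega]addrA dsum_reflect_le -dsum_ltS.
rewrite [in RHS]leNgt; case: ltP => _ /=.
  congr (omap _ (wfun p _)); rewrite opprB !addrA.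
  by rewrite [wlen p + wlen q + _]addrAC.
by congr (omap _ (wfun q _)); rewrite [wlen p + _]addrC [_ - b - _]addrAC addrK.
Qed.

(* The monoid W(A, Gamma); p^-1 is the involution bar p of W(A, Gamma), which
   is not an inverse. *)
HB.instance Definition _ := isStarMonoid.Build word wcatA wcat1w winvK winvM.

Fact wletter_dom (a : letter) (b : A) :
  (if b == t0 Omega then Some a else None)
    = (t0 Omega <= b <= t0 Omega) :> bool.
Proof. by rewrite -eq_le eq_sym; case: eqP. Qed.

Definition wletter (a : letter) : word :=
  Word (ltW (t0_gt0 Omega)) (wletter_dom a).

(* The finite word given by an element of Gamma^* *)
Definition wseq (s : seq letter) : word := (\prod_(a <- s) wletter a)%g.

Definition G_reduced (x : word) : Prop :=
  forall (p : word) (f : seq letter) (q : word),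
    x = (p * wseq f * q)%g -> f <> [::] -> eval f <> 1%g.

Definition Rstar : word -> Prop := submonoid_gen G_reduced.

Inductive Mcongr : word -> word -> Prop :=
| Mcongr_rel (u : word) (l r : seq letter) :
    G_reduced u -> eval l = eval r ->
    Mcongr (u * wseq l * (wseq r)^-1 * u^-1)%g 1%g
| Mcongr_refl x : Mcongr x x
| Mcongr_sym x y : Mcongr x y -> Mcongr y x
| Mcongr_trans y x z : Mcongr x y -> Mcongr y z -> Mcongr x z
| Mcongr_mul x x' y y' :
    Mcongr x x' -> Mcongr y y' -> Mcongr (x * y)%g (x' * y')%g.

End Words.

(* -------------------------------------------------------------------- *)
Section GroupE.

Variables (d : Order.disp_t) (Omega : bOrderType d).
Variables (G : groupType) (Sigma : {pred G}).

Local Notation W := (word Omega Sigma).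
Local Open Scope quotient_scope.

Definition Mcongrb (x y : W) : bool := `[< Mcongr x y >].

Fact Mcongrb_equiv : equiv_class_of Mcongrb.
Proof.
split=> [x|x y|y x z]; first exact/asboolP/Mcongr_refl.
- by apply: asbool_equiv_eq; split=> /Mcongr_sym.
- by move=> /asboolP xy /asboolP yz; apply/asboolP/(Mcongr_trans xy).
Qed.

Canonical Mcongrb_equivRel := EquivRelPack Mcongrb_equiv.

(* The quotient monoid M(A, G) *)
Definition MAG := {eq_quot Mcongrb}.

HB.instance Definition _ := Choice.on MAG.
HB.instance Definition _ := EqQuotient.on MAG.

Definition Mclass (x : W) : MAG := \pi_MAG x.

Lemma MclassP (x y : W) : Mclass x = Mclass y <-> Mcongr x y.
Proof.
split=> [/eqmodP/asboolP //|xy]; exact/eqmodP/asboolP.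
Qed.

Definition Mone : MAG := Mclass 1%g.
Definition Mmul (x y : MAG) : MAG := Mclass (repr x * repr y)%g.

Lemma MclassM x y : Mmul (Mclass x) (Mclass y) = Mclass (x * y)%g.
Proof. by apply/MclassP/Mcongr_mul; apply/MclassP; rewrite /Mclass reprK. Qed.

Lemma Mclass_repr (x : MAG) : Mclass (repr x) = x.
Proof. exact: reprK. Qed.

Fact MmulA : associative Mmul.
Proof.
move=> x y z; rewrite -(Mclass_repr x) -(Mclass_repr y) -(Mclass_repr z).
by rewrite !MclassM mulgA.
Qed.

Fact Mmul1 : left_id Mone Mmul.
Proof. by move=> x; rewrite -(Mclass_repr x) MclassM mul1g. Qed.

Fact Mmulr1 : right_id Mone Mmul.
Proof. by move=> x; rewrite -(Mclass_repr x) MclassM mulg1. Qed.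

HB.instance Definition _ := isMonoid.Build MAG MmulA Mmul1 Mmulr1.

Fact Mclass_monoid_morphism : monoid.monoid_morphism Mclass.
Proof. by split=> // x y; rewrite -MclassM. Qed.

HB.instance Definition _ :=
  isUMagmaMorphism.Build W MAG Mclass Mclass_monoid_morphism.

Lemma Rstar1 : Rstar (1%g : W).
Proof. by move=> T [T1 _] _. Qed.

Lemma RstarM (x y : W) : Rstar x -> Rstar y -> Rstar (x * y)%g.
Proof. by move=> Rx Ry T mT XT; apply: mT.2; [apply: Rx | apply: Ry]. Qed.

Lemma Rstar_reduced (x : W) : G_reduced x -> Rstar x.
Proof. by move=> Rx T _; apply. Qed.

Lemma wletterV (a : letter Sigma) :
  ((wletter Omega a)^-1)%g = wletter Omega (letterV a).
Proof.
apply: word_ext => //= b.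
by rewrite subr_eq (inj_eq (addrI _)) eq_sym; case: ifP.
Qed.

Lemma wseqV (s : seq (letter Sigma)) :
  ((wseq Omega s)^-1)%g = wseq Omega (rev (map (@letterV G Sigma) s)).
Proof.
rewrite /wseq; elim: s => [|a s IHs]; first by rewrite !big_nil invg1.
by rewrite big_cons invgM IHs wletterV /= rev_cons big_rcons.
Qed.

Lemma eval_revV (s : seq (letter Sigma)) :
  eval (rev (map (@letterV G Sigma) s)) = ((eval s)^-1)%g.
Proof.
by rewrite /eval -map_rev big_map prodgV revK.
Qed.

Lemma G_reducedV (x : W) : G_reduced x -> G_reduced (x^-1)%g.
Proof.
move=> Rx p f q def_x nz_f evf.
apply: (Rx (q^-1)%g (rev (map (@letterV G Sigma) f)) (p^-1)%g).
- by rewrite -wseqV -!invgM mulgA -def_x invgK.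
- by move=> /(congr1 size)/eqP; rewrite size_rev size_map size_eq0 => /eqP.
by rewrite eval_revV evf invg1.
Qed.

Lemma MclassV (x : W) : G_reduced x -> (Mclass x * Mclass (x^-1))%g = 1%g.
Proof.
move=> Rx; rewrite -gmulfM; apply/MclassP.
have := @Mcongr_rel _ _ _ _ x [::] [::] Rx (erefl _).
by rewrite /wseq !big_nil invg1 !mulg1.
Qed.

Definition EAG_pred : {pred MAG} :=
  [pred m | `[< exists2 x : W, Rstar x & m = Mclass x >]].

Lemma EAG_predP m : reflect (exists2 x : W, Rstar x & m = Mclass x) (m \in EAG_pred).
Proof. exact: asboolP. Qed.

Fact EAG_pred_closed : monoid_closed EAG_pred.
Proof.
split=> [|_ _ /EAG_predP[x Rx ->] /EAG_predP[y Ry ->]]; apply/EAG_predP.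
  by exists 1%g; first exact: Rstar1.
by exists (x * y)%g; [exact: RstarM | rewrite gmulfM].
Qed.

(* The submonoid E(A, G) of M(A, G) *)
Record EAG := InEAG { Eval : MAG; EvalP : Eval \in EAG_pred }.

HB.instance Definition _ := [isSub for Eval].
HB.instance Definition _ := [Choice of EAG by <:].
HB.instance Definition _ :=
  SubChoice_isSubMonoid.Build MAG EAG_pred EAG EAG_pred_closed.

Lemma Rstar_inv_ex (x : W) : Rstar x ->
  exists2 y : W, Rstar y &
    (Mclass y * Mclass x = 1 /\ Mclass x * Mclass y = 1)%g.
Proof.
pose T : {pred W} := [pred x | `[< exists2 y : W, Rstar y &
  (Mclass y * Mclass x = 1 /\ Mclass x * Mclass y = 1)%g >]].
suff Tgen : forall x, Rstar x -> x \in T by move=> /Tgen/asboolP.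
move=> {}x; apply=> [|{}x Rx].
  split=> [|{}x y /asboolP[x' Rx' [x'x xx']] /asboolP[y' Ry' [y'y yy']]].
    by apply/asboolP; exists 1%g; rewrite ?gmulf1 ?mulg1 //; exact: Rstar1.
  apply/asboolP; exists (y' * x')%g; first exact: RstarM.
  rewrite !gmulfM; split.
    by rewrite mulgA -[(_ * _ * Mclass x)%g]mulgA x'x mulg1.
  by rewrite mulgA -[(_ * _ * Mclass y')%g]mulgA yy' mulg1.
apply/asboolP; exists (x^-1)%g; first exact/Rstar_reduced/G_reducedV.
split; last exact: MclassV.
by rewrite -[in RHS](MclassV (G_reducedV Rx)) invgK.
Qed.

Lemma EAG_inv_ex (x : EAG) : exists y : EAG, (y * x = 1 /\ x * y = 1)%g.
Proof.
case/EAG_predP: (EvalP x) => w /Rstar_inv_ex[v Rv [vw wv]] def_x.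
have Ev : Mclass v \in EAG_pred by apply/EAG_predP; exists v.
by exists (InEAG Ev); split; apply: val_inj; rewrite gmulfM /= def_x ?vw ?wv.
Qed.

Definition Einv (x : EAG) : EAG := sval (cid (EAG_inv_ex x)).

HB.instance Definition _ := hasInv.Build EAG Einv.

Fact EmulVg : left_inverse 1%g Einv (@monoid.mul EAG).
Proof. by move=> x; rewrite /Einv; case: cid => y []. Qed.

Fact EmulgV : right_inverse 1%g Einv (@monoid.mul EAG).
Proof. by move=> x; rewrite /Einv; case: cid => y []. Qed.

HB.instance Definition _ := Monoid_isGroup.Build EAG EmulVg EmulgV.

End GroupE.

(* Main.v *)
Require Import Defs.
From mathcomp Require Import all_boot all_order all_algebra all_fingroup.
From mathcomp Require Import boolp wochoice freeg zify.

(** If a reduced word [w] is its own involute, then [w * w = w * w^-1] is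
    trivial in E(A, G), so the class of [w] is either 1 or an element of order
    2, and in both cases it lies in the subgroup generated by the elements of
    order 2. It therefore suffices to write every reduced word, in E(A, G), as a
    product of reduced words that are their own involutes
    ([gen_class_reduced]).

    Suppose first that the nonempty word [v] is cyclically reduced, so that its
    powers are reduced too. Let [e] be the successor of the degree of [wlen v]
    and let [L] be the generator t_e of A. An element of [1, L] lies below some
    multiple of [wlen v], or the distance from it to [L] does, and never both;
    this is where the limit hypothesis on Omega enters ([exists_reflection]).
    So there is a word [mirror] of length [L] that starts with the infinite
    power v v v ... and ends with the infinite power ... v^-1 v^-1. It is its
    own involute ([mirrorV]), and it is reduced: its only seam is not between
    two consecutive positions, since no finite factor meets both halves
    ([mirror_reduced]). Putting one more copy of [v] in front of it gives the
    word of the same shape with length [L + wlen v] ([mulg_mirror]), again its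
    own involute. Hence [v] is the product of the involutions [v * mirror] and
    [mirror] ([gen_class_cyclic]).

    For an arbitrary nonempty reduced word [u], there are enough letters, as
    Sigma has two elements, to find a letter [c] that cancels neither against
    the last letter of [u] nor against the first one. Both [u * c] and [c] are
    then cyclically reduced, and [u] equals [u * c * c^-1] in E(A, G).

    For G free, being G-reduced is a condition on consecutive letters
    ([G_reduced_freely], [freely_reduced_G]). This rests on the nontriviality of
    nonempty freely reduced products of basis elements, which is obtained from
    the universal property by acting on a finite path
    ([eval_freely_reduced]). *)

Set Implicit Arguments.
Unset Strict Implicit.
Unset Printing Implicit Defensive.

Import Order.TTheory GRing.Theory Num.Theory.

Local Open Scope ring_scope.

(** * Reduced products in a free group *)

Section FreeGroup.
Variables (G : groupType) (Sigma : {pred G}).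
Local Notation letter := (letter Sigma).

(** A partial injection of a finite set, listed as a sequence of pairs, extends
    to a permutation: pairs are added one at a time, and a transposition after
    the permutation built so far corrects the image of the new point without
    moving the images already prescribed. *)
Lemma partial_injection_perm (T : finType) (l : seq (T * T)) :
    {in l &, forall p q, (p.1 == q.1) = (p.2 == q.2)} ->
  exists s : {perm T}, {in l, forall p, s p.1 = p.2}.
Proof.
elim: l => [|p l IHl] inj_l; first by exists 1%g.
have [q r ql rl|s sl] := IHl; first by apply: inj_l; rewrite inE ?ql ?rl orbT.
exists (s * tperm (s p.1) p.2)%g => q; rewrite inE permM.
case/predU1P => [->|ql]; first by rewrite tpermL.
have := inj_l q p; rewrite !inE ql eqxx orbT => /(_ isT isT) eq_qp.
have [/eqP|neq1] := boolP (q.1 == p.1).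
  by move=> eq1; move: eq_qp; rewrite eq1 eqxx tpermL => /esym/eqP.
rewrite -(sl q ql) tpermD ?(inj_eq perm_inj) 1?eq_sym //.
by rewrite sl // -eq_qp.
Qed.

(** The letters of [s] label the edges of the path 0, 1, ..., [size s]. For a
    group element [x], the edges labelled [x], read forwards, and those labelled
    [x^-1], read backwards, form a partial injection of the vertices exactly
    because no letter of [s] is followed by its inverse. *)
Lemma path_perm (a0 : letter) (s : seq letter) (x : G) :
    sorted (fun a b => b != letterV a) s ->
  exists t : {perm 'I_(size s).+1}, forall i, (i < size s)%N ->
    (val (nth a0 s i) = x -> t (inord i) = inord i.+1) /\
    (val (nth a0 s i) = x^-1%g -> t (inord i.+1) = inord i).
Proof.
move=> /sortedP/= red_s; set n := size s.
pose fwd := [seq (inord i, inord i.+1) : 'I_n.+1 * 'I_n.+1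
             | i <- iota 0 n & val (nth a0 s i) == x].
pose bwd := [seq (inord i.+1, inord i) : 'I_n.+1 * 'I_n.+1
             | i <- iota 0 n & val (nth a0 s i) == x^-1%g].
have inordE i j : (i <= n)%N -> (j <= n)%N ->
  ((inord i : 'I_n.+1) == inord j) = (i == j).
  by move=> le_in le_jn; rewrite -val_eqE /= !inordK.
have red i : (i.+1 < n)%N -> val (nth a0 s i.+1) <> (val (nth a0 s i))^-1%g.
  by move=> lt_in eq_s; move/eqP: (red_s a0 i lt_in); apply; apply: val_inj.
have [|t tP] := @partial_injection_perm _ (fwd ++ bwd).
  have fwdP p : p \in fwd -> exists i, [/\ (i < n)%N, val (nth a0 s i) = x
      & p = (inord i, inord i.+1)].
    move=> /mapP[i]; rewrite mem_filter mem_iota => /andP[/eqP s_i lt_in] ->.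
    by exists i; split.
  have bwdP p : p \in bwd -> exists i, [/\ (i < n)%N, val (nth a0 s i) = x^-1%g
      & p = (inord i.+1, inord i)].
    move=> /mapP[i]; rewrite mem_filter mem_iota => /andP[/eqP s_i lt_in] ->.
    by exists i; split.
  have mixed p q : p \in fwd -> q \in bwd -> (p.1 == q.1) = (p.2 == q.2).
    move=> /fwdP[i [lt_in s_i ->]] /bwdP[j [lt_jn s_j ->]] /=.
    rewrite !inordE ?(ltnW lt_in) ?(ltnW lt_jn) //.
    case: eqP => [def_i|_].
      by case: (red j); rewrite -?def_i // s_i s_j invgK.
    by case: eqP => // def_j; case: (red i); rewrite def_j ?s_j ?s_i.
  move=> p q; rewrite !mem_cat => /orP[] pP /orP[] qP.
  - case/fwdP: pP => i [lt_in _ ->]; case/fwdP: qP => j [lt_jn _ ->] /=.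
    by rewrite !inordE ?(ltnW lt_in) ?(ltnW lt_jn).
  - exact: mixed.
  - by rewrite [LHS]eq_sym [RHS]eq_sym; apply: mixed.
  case/bwdP: pP => i [lt_in _ ->]; case/bwdP: qP => j [lt_jn _ ->] /=.
  by rewrite !inordE ?(ltnW lt_in) ?(ltnW lt_jn).
exists t => i lt_in; split=> s_i.
  apply: (tP (inord i, inord i.+1)); rewrite mem_cat; apply/orP; left.
  by apply/mapP; exists i; rewrite ?mem_filter ?mem_iota /= ?s_i ?eqxx.
apply: (tP (inord i.+1, inord i)); rewrite mem_cat; apply/orP; right.
by apply/mapP; exists i; rewrite ?mem_filter ?mem_iota /= ?s_i ?eqxx.
Qed.

Lemma multiplicative1 (H : groupType) (phi : {multiplicative G -> H}) :
  phi 1%g = 1%g.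
Proof. by apply: (mulgI (phi 1%g)); rewrite -gmulfM !mulg1. Qed.

Lemma multiplicativeV (H : groupType) (phi : {multiplicative G -> H}) :
  {morph phi : x / (x^-1)%g}.
Proof.
by move=> x; apply: (mulgI (phi x)); rewrite -gmulfM !mulgV multiplicative1.
Qed.

Hypothesis G_free : free_basis Sigma.

(** Sending each basis element to its permutation of the vertices of the path
    labelled by [s] makes [s] act by walking from one end of the path to the
    other, so the value of [s] acts nontrivially. *)
Lemma eval_freely_reduced (s : seq letter) :
  sorted (fun a b => b != letterV a) s -> s <> [::] -> eval s <> 1%g.
Proof.
case: s => // a0 s0; set s := a0 :: s0 => red_s _ eval1.
pose f x := sval (cid (path_perm a0 x red_s)).
have fP x := svalP (cid (path_perm a0 x red_s)); rewrite -/(f _) in fP.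
have [phi [phif _]] := G_free f.
have step i : (i < size s)%N -> phi (val (nth a0 s i)) (inord i) = inord i.+1.
  move=> lt_is; have /orP[Sa|Sa] := valP (nth a0 s i).
    by rewrite phif //; apply: (fP _ i lt_is).1.
  rewrite -[val _]invgK multiplicativeV phif //.
  apply: (canLR (permK _)); apply/esym; apply: (fP _ i lt_is).2.
  by rewrite invgK.
have walk i : (i <= size s)%N -> phi (eval (take i s)) (inord 0) = inord i.
  elim: i => [_|i IHi lt_is].
    by rewrite take0 /eval big_nil multiplicative1 perm1.
  rewrite (take_nth a0) // /eval -cats1 big_cat big_seq1 /= gmulfM permM.
  by rewrite -/(eval _) IHi ?step // ltnW.
have := walk _ (leqnn _); rewrite take_size eval1 multiplicative1 perm1.
by move/(congr1 val); rewrite /= !inordK.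
Qed.

(** Map all of [Sigma] to an element of order 3: if [x] and [x^-1] were both in
    [Sigma], that element would be its own inverse. *)
Lemma free_basisV x : x \in Sigma -> (x^-1)%g \notin Sigma.
Proof.
move=> Sx; apply/negP => Sx'.
have [phi [phif _]] := G_free (fun=> inZp 1 : 'I_3).
by have := multiplicativeV phi x; rewrite !phif.
Qed.

Lemma letterV_neq (a : letter) : a <> letterV a.
Proof.
move=> /(congr1 val)/= eq_a; have := valP a; rewrite /= -eq_a orbb => Sa.
by have := free_basisV Sa; rewrite -eq_a Sa.
Qed.

End FreeGroup.

(** * Bounded elements of the ordered group *)

Section DirectSumOrder.
Variables (d : Order.disp_t) (Omega : bOrderType d).
Local Notation A := (dsum Omega).
Local Notation t0 := (t0 Omega).
Implicit Types a b c : A.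

Lemma dsum_leBl a b c : (a - b <= c) = (a <= c + b).
Proof. by rewrite -[LHS](dsum_leD2r b) subrK. Qed.

Lemma dsum_leBr a b c : (a <= c - b) = (a + b <= c).
Proof. by rewrite -[LHS](dsum_leD2r b) subrK. Qed.

Lemma dsum_ltBr a b c : (a < c - b) = (a + b < c).
Proof. by rewrite -[LHS](dsum_ltD2r b) subrK. Qed.

Lemma dsum_addr_gt0 a b : 0 < a -> 0 < b -> 0 < a + b.
Proof.
by move=> a0 b0; apply: lt_trans b0 _; rewrite -[ltLHS]add0r dsum_ltD2r.
Qed.

Lemma dsum_ltDr a b : (a < a + b) = (0 < b).
Proof. by rewrite addrC -[ltLHS]add0r dsum_ltD2r. Qed.

(** For [0 < a], this is the initial segment of A formed by 0, the negative
    elements and the elements whose degree is at most that of [a]. *)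
Definition bounded a b : Prop := exists n, b <= a *+ n.

Lemma bounded_le a b c : b <= c -> bounded a c -> bounded a b.
Proof. by move=> le_bc [n le_cn]; exists n; apply: le_trans le_cn. Qed.

Lemma boundedD a b c : bounded a b -> bounded a c -> bounded a (b + c).
Proof.
move=> [n le_bn] [m le_cm]; exists (n + m)%N; rewrite mulrnDr.
apply: (@le_trans _ _ (a *+ n + c)); first by rewrite dsum_leD2r.
by rewrite ![a *+ n + _]addrC dsum_leD2r.
Qed.

Lemma bounded_self a : bounded a a.
Proof. by exists 1%N. Qed.

Lemma bounded_le0 a b : b <= 0 -> bounded a b.
Proof. by exists 0%N. Qed.

Lemma boundedDr a b : 0 < a -> bounded a (b + a) <-> bounded a b.
Proof.
move=> a_gt0; split=> [|bd_b]; last exact: boundedD (bounded_self a).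
by apply: bounded_le; rewrite ltW // dsum_ltDr.
Qed.

(** The coefficients are integers, so degrees decide: if [b] has degree at most
    that of [a], some multiple of [a] has a larger coefficient than [b] in the
    degree of [a]. *)
Lemma unboundedP a b : 0 < a ->
  ~ bounded a b <->
  exists i, [/\ (lead a < i)%O, 0 < coeff i b
    & forall k, (i < k)%O -> coeff k b = 0].
Proof.
move=> a_gt0; split=> [unb|[i [lt_ai bi bi0]] [n]]; last first.
  apply/negP; rewrite -ltNge dsum_ltE; apply/positiveP.
  exists i => [|k lt_ik]; rewrite coeffB coeffMn.
    by rewrite (coeff_gt_lead lt_ai) mul0rn subr0.
  by rewrite (coeff_gt_lead (lt_trans lt_ai lt_ik)) mul0rn subr0 bi0.
have /positiveP[i bi bi0] : positive b.
  by rewrite -dsum_gt0 ltNge; apply/negP => /bounded_le0.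
exists i; split=> //; rewrite ltNge; apply/negP => le_ia; apply: unb.
exists (`|coeff (lead a) b|.+1)%N; apply: ltW; rewrite dsum_ltE; apply/positiveP.
exists (lead a) => [|k lt_ak]; rewrite coeffB coeffMn.
  move: a_gt0; rewrite dsum_gt0 => /andP[_]; rewrite -mulr_natr; nia.
by rewrite (coeff_gt_lead lt_ak) mul0rn sub0r bi0 ?oppr0 ?(le_lt_trans le_ia).
Qed.

(** The map [b |-> t_e + t0 - b] reverses the positions of a word of length t_e.
    It exchanges the bounded and the unbounded elements because no degree lies
    strictly between that of [a] and [e]: an unbounded [b] in [1, t_e] has
    degree [e] with coefficient 1, and the difference [t_e - b] cancels it. *)
Lemma exists_reflection a (e : Omega) : 0 < a -> is_succ (lead a) e ->
  forall b, bounded a (tgen e + t0 - b) <-> ~ bounded a b.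
Proof.
move=> a_gt0 [lt_ae min_e] b.
have coeffE i : (lead a < i)%O ->
    coeff i (tgen e + t0 - b) = (e == i)%:R - coeff i b.
  move=> lt_ai; rewrite coeffB coeffD !coeffU !mul1r.
  by rewrite (lt_eqF (le_lt_trans (le0x _) lt_ai)) addr0.
split=> [bd1 bd2|unb].
  have := boundedD bd1 bd2; rewrite subrK; apply/unboundedP => //.
  exists e; split=> // [|k lt_ek].
    rewrite coeffD !coeffU !mul1r eqxx (lt_eqF (le_lt_trans (le0x _) lt_ae)).
    by rewrite addr0.
  rewrite coeffD !coeffU !mul1r (lt_eqF lt_ek).
  by rewrite (lt_eqF (le_lt_trans (le0x _) lt_ek)) addr0.
apply: contrapT => /(unboundedP _ a_gt0)[j [lt_aj cj cj0]].
have [i [lt_ai bi bi0]] := (unboundedP b a_gt0).1 unb.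
case: (ltgtP i j) => [lt_ij|lt_ji|eq_ij].
- move: cj; rewrite coeffE // bi0 // lt_eqF //.
  exact: le_lt_trans (min_e i lt_ai) lt_ij.
- have := cj0 i lt_ji; rewrite coeffE // lt_eqF.
    by rewrite sub0r => /eqP; rewrite oppr_eq0 gt_eqF.
  exact: le_lt_trans (min_e j lt_aj) lt_ji.
by move: cj; rewrite coeffE // -eq_ij; case: eqP => _; lia.
Qed.

End DirectSumOrder.

(** * Words without cancelling neighbours *)

Section Words.
Variables (d : Order.disp_t) (Omega : bOrderType d).
Variables (G : groupType) (Sigma : {pred G}).
Local Notation A := (dsum Omega).
Local Notation t0 := (t0 Omega).
Local Notation letter := (letter Sigma).
Local Notation W := (word Omega Sigma).

Lemma wlenM (p q : W) : wlen (p * q)%g = wlen p + wlen q.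
Proof. by []. Qed.

Lemma wfunM (p q : W) b :
  (p * q)%g b = if b <= wlen p then p b else q (b - wlen p).
Proof. by []. Qed.

Lemma wfunV (p : W) b :
  (p^-1)%g b = omap (@letterV G Sigma) (p (wlen p + t0 - b)).
Proof. by []. Qed.

Lemma wfunMr (p q : W) b : 0 < b -> (p * q)%g (b + wlen p) = q b.
Proof.
by move=> b_gt0; rewrite wfunM leNgt addrC dsum_ltDr b_gt0 [_ + b]addrC addrK.
Qed.

Lemma wfun_Some (p : W) b a : p b = Some a -> 0 < b <= wlen p.
Proof. by move=> pb; rewrite -t0_le -(wfun_dom p) pb. Qed.

Lemma wfun_ex (p : W) b : 0 < b -> b <= wlen p -> exists a, p b = Some a.
Proof.
move=> b_gt0 b_le; have := wfun_dom p b; rewrite t0_le b_gt0 b_le.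
by case: (p b) => // a _; exists a.
Qed.

Lemma word_split (x : W) b : 0 <= b -> b <= wlen x ->
  exists p q : W, wlen p = b /\ x = (p * q)%g.
Proof.
move=> b_ge0 b_le.
have p_dom g : (if g <= b then x g else None) = (t0 <= g <= b) :> bool.
  case: ifP => [le_gb|_]; rewrite ?andbF // andbT wfun_dom.
  by rewrite (le_trans le_gb b_le) andbT.
have q_ge0 : 0 <= wlen x - b by rewrite dsum_subr_ge0.
have q_dom g : (if 0 < g then x (g + b) else None)
    = (t0 <= g <= wlen x - b) :> bool.
  rewrite t0_le; case: ifP => //= g_gt0.
  rewrite wfun_dom t0_le dsum_leBr (lt_le_trans g_gt0) //.
  by rewrite addrC -[leLHS]add0r dsum_leD2r.
exists (Word b_ge0 p_dom), (Word q_ge0 q_dom); split=> //.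
apply: word_ext => [|g]; first by rewrite wlenM /= addrC subrK.
rewrite wfunM /=; case: (leP g b) => // lt_bg.
by rewrite dsum_ltBr add0r /= lt_bg subrK.
Qed.

Lemma word_cons (x : W) a : x t0 = Some a ->
  exists y : W, x = (wletter Omega a * y)%g.
Proof.
move=> xa; have /andP[_ le_x] := wfun_Some xa.
have [p [q [len_p def_x]]] := word_split (ltW (t0_gt0 _)) le_x.
exists q; rewrite def_x; congr (_ * _)%g; apply: word_ext => //= b.
case: eqP => [->|nb]; first by rewrite -xa def_x wfunM len_p lexx.
by rewrite wfun_out // len_p -eq_le eq_sym; apply/eqP.
Qed.

Definition freely_reduced (x : W) : Prop :=
  forall b a, x b = Some a -> x (b + t0) <> Some (letterV a).

Lemma freely_reducedM (p q : W) :
    freely_reduced p -> freely_reduced q ->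
    (forall a, p (wlen p) = Some a -> q t0 <> Some (letterV a)) ->
  freely_reduced (p * q)%g.
Proof.
move=> red_p red_q red_pq b a; rewrite !wfunM -dsum_ltS [in X in X -> _]le_eqVlt.
case: (ltgtP b (wlen p)) => [_||->] /=; first exact: red_p.
  by move=> _ qb; rewrite addrAC; apply: red_q.
by rewrite addrAC subrr add0r; apply: red_pq.
Qed.

Lemma freely_reduced_letter c :
  c <> letterV c -> freely_reduced (wletter Omega c).
Proof.
move=> nc b a /=; case: eqP => // -> _; case: eqP => // /eqP.
by rewrite -subr_eq0 addrK gt_eqF ?t0_gt0.
Qed.

(** Positions in a finite factor of a word over A are shifted by the length of
    the prefix, hence the freedom in [p]. *)
Lemma freely_reduced_sorted (s : seq letter) (p q : W) :
    freely_reduced (p * wseq Omega s * q)%g ->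
  sorted (fun a b => b != letterV a) s.
Proof.
elim: s p => [|a [|b s] IHs] // p; rewrite /wseq big_cons mulgA => red_x.
apply/andP; split; last exact: IHs red_x.
apply/eqP => eq_b.
rewrite big_cons -!mulgA in red_x.
apply: (red_x (t0 + wlen p) a).
  by rewrite wfunMr ?t0_gt0 // wfunM lexx /= eqxx.
rewrite addrAC wfunMr ?dsum_addr_gt0 ?t0_gt0 //.
rewrite (wfunMr (wletter Omega a)) ?t0_gt0 //.
by rewrite wfunM lexx /= eqxx eq_b.
Qed.

(** A cancelling pair of consecutive letters is a factor of length 2 with value
    1: cut [x] in front of the pair, then peel off its two letters. *)
Lemma G_reduced_freely (x : W) : G_reduced x -> freely_reduced x.
Proof.
move=> red_x b a xb xSb.
have /andP[b_gt0 le_b] := wfun_Some xb; have /andP[_ le_Sb] := wfun_Some xSb.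
have [||p [y [len_p def_x]]] := @word_split x (b - t0).
- by rewrite dsum_subr_ge0 t0_le.
- by rewrite dsum_leBl (le_trans le_b) // ltW // dsum_ltDr t0_gt0.
have yE g : 0 < g -> y g = x (g + (b - t0)).
  by move=> g_gt0; rewrite def_x -len_p wfunMr.
have [y' def_y] : exists y', y = (wletter Omega a * y')%g.
  by apply: word_cons; rewrite yE ?t0_gt0 // addrC subrK.
have [y'' def_y'] : exists y'', y' = (wletter Omega (letterV a) * y'')%g.
  apply: word_cons; rewrite -xSb.
  rewrite -(wfunMr (wletter Omega a)) ?t0_gt0 // -def_y.
  rewrite yE ?dsum_addr_gt0 ?t0_gt0 //=.
  by congr (x _); rewrite addrACA subrr addr0 addrC.
apply: (red_x p [:: a; letterV a] y''); rewrite // ?/eval.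
  by rewrite def_x def_y def_y' /wseq !big_cons big_nil mulg1 !mulgA.
by rewrite !big_cons big_nil mulg1 mulgV.
Qed.

Lemma freely_reduced_G (x : W) :
  free_basis Sigma -> freely_reduced x -> G_reduced x.
Proof.
move=> G_free red_x p s q def_x; apply: eval_freely_reduced => //.
by rewrite def_x in red_x; apply: freely_reduced_sorted red_x.
Qed.

End Words.

(** * Mirror words *)

Section Mirror.
Variables (d : Order.disp_t) (Omega : bOrderType d).
Variables (G : groupType) (Sigma : {pred G}).
Local Notation A := (dsum Omega).
Local Notation t0 := (t0 Omega).
Local Notation letter := (letter Sigma).
Local Notation W := (word Omega Sigma).

Variable v : W.
Hypothesis v_gt0 : 0 < wlen v.

(** The infinite power v v v ..., which is not a word since its domain, the
    positive elements bounded by a multiple of [wlen v], has no greatest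
    element. The copy of [v] that contains [b] is found from the least multiple
    of [wlen v] that is at least [b]. *)
Definition omega_power (b : A) : option letter :=
  if pselect (bounded (wlen v) b) is left bd then
    v (b - wlen v *+ (ex_minn bd).-1) else None.

Lemma omega_power_low b : b <= wlen v -> omega_power b = v b.
Proof.
move=> le_b; rewrite /omega_power; case: pselect => [bd|[]]; last by exists 1%N.
case: ex_minnP => m _ min_m; have := min_m 1%N le_b.
by case: m {min_m} => [|[]] //= _; rewrite subr0.
Qed.

Lemma omega_power_shift b : 0 < b -> omega_power (b + wlen v) = omega_power b.
Proof.
move=> b_gt0; rewrite /omega_power.
have bdE := boundedDr b v_gt0.
case: pselect => [bdS|nbdS]; last first.
  by case: pselect => // bd; case: nbdS; apply/bdE.
case: pselect => [bd|[]]; last exact/bdE.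
case: ex_minnP => m le_bm min_m; case: ex_minnP => n le_bn min_n.
have n_gt0 : (0 < n)%N.
  by case: n le_bn {min_n} => //; rewrite leNgt b_gt0.
have m_gt0 : (0 < m)%N.
  by case: m le_bm {min_m} => //; rewrite leNgt dsum_addr_gt0.
have le_m : (m <= n.+1)%N by apply: min_m; rewrite mulrSr dsum_leD2r.
have le_n : (n <= m.-1)%N.
  by apply: min_n; rewrite -(dsum_leD2r (wlen v)) -mulrSr prednK.
have -> : m = n.+1 by lia.
case: n n_gt0 {min_n le_bn le_m le_n} => //= n _.
by rewrite mulrSr opprD addrACA subrr addr0.
Qed.

(** The least multiple [n] of [wlen v] that is at least [b] is 0 when [b <= 0],
    which makes the predecessor of [n] harmless there; otherwise [b] lies in
    the [n]-th copy of [v]. *)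
Lemma omega_power_dom b :
  bounded (wlen v) b -> omega_power b = (0 < b) :> bool.
Proof.
move=> bd; rewrite /omega_power; case: pselect => // {}bd.
case: ex_minnP => [[|m] le_bm min_m] /=.
  by rewrite subr0 wfun_dom t0_le ltNge le_bm.
rewrite wfun_dom t0_le dsum_ltBr add0r dsum_leBl addrC -mulrSr le_bm andbT.
case: (leP b 0) => [b_le0|b_gt0]; first by have := min_m 0%N b_le0.
by rewrite ltNge; apply/negP => /min_m; rewrite ltnn.
Qed.

Section Length.
Variable L : A.
Hypothesis Lrefl :
  forall b, bounded (wlen v) (L + t0 - b) <-> ~ bounded (wlen v) b.

(** The word v v v ... followed by ... v^-1 v^-1, with the second half obtained
    by reflecting the first and inverting its letters. The length [L] is left
    general because prefixing a copy of [v] changes it to [L + wlen v]. *)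
Definition mirror_fun (b : A) : option letter :=
  if `[< bounded (wlen v) b >] then omega_power b
  else omap (@letterV G Sigma) (omega_power (L + t0 - b)).

Lemma mirror_unbounded b : L + t0 <= b -> ~ bounded (wlen v) b.
Proof.
move=> le_b bd; apply: (Lrefl (L + t0)).1; last exact: bounded_le bd.
by rewrite subrr; apply: bounded_le0.
Qed.

Fact mirror_ge0 : 0 <= L.
Proof.
rewrite leNgt; apply/negP; rewrite dsum_ltS => le0.
by apply: (mirror_unbounded (lexx _)); apply: bounded_le0.
Qed.

Fact mirror_dom b : mirror_fun b = (t0 <= b <= L) :> bool.
Proof.
rewrite /mirror_fun t0_le; case: asboolP => [bd|unb].
  rewrite omega_power_dom //; case: (leP b 0) => //= _; apply/esym.
  rewrite leNgt; apply/negP; rewrite dsum_ltS => le_b.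
  exact: mirror_unbounded le_b bd.
have -> : omap (@letterV G Sigma) (omega_power (L + t0 - b))
  = omega_power (L + t0 - b) :> bool by case: (omega_power _).
rewrite omega_power_dom; last exact/Lrefl.
have -> : 0 < b by rewrite ltNge; apply/negP => /bounded_le0.
by rewrite dsum_ltBr add0r dsum_ltS dsum_leD2r.
Qed.

Definition mirror : W := Word mirror_ge0 mirror_dom.

Lemma mirrorV : (mirror^-1)%g = mirror.
Proof.
apply: word_ext => // b; rewrite wfunV /= /mirror_fun.
case: asboolP => [/Lrefl unb|unb].
  by rewrite asboolF.
rewrite asboolT; last by apply: contrapT => /Lrefl.
by rewrite subKr; case: omega_power => //= a; rewrite letterVK.
Qed.

Hypothesis red_v : freely_reduced v.
Hypothesis cyc_v : forall a, v (wlen v) = Some a -> v t0 <> Some (letterV a).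

(** By induction on the number of the copy of [v]: consecutive positions in the
    first copy belong to [v], the seam of the first two copies is free of
    cancellation as [v] is cyclically reduced, and later copies repeat this. *)
Lemma omega_power_reduced b a :
  omega_power b = Some a -> omega_power (b + t0) <> Some (letterV a).
Proof.
move=> pb.
have bd : bounded (wlen v) b.
  by move: pb; rewrite /omega_power; case: pselect.
have b_gt0 : 0 < b by rewrite -omega_power_dom // pb.
case: bd => n; elim: n => [|n IHn] in b pb b_gt0 *; first by rewrite leNgt b_gt0.
case: (ltgtP b (wlen v)) => [lt_bv _|lt_vb le_bn|eq_bv _].
- move: pb; rewrite !omega_power_low -?dsum_ltS ?ltW //; exact: red_v.
- have b'_gt0 : 0 < b - wlen v by rewrite dsum_ltBr add0r.
  have := @IHn (b - wlen v); rewrite addrAC -(omega_power_shift b'_gt0).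
  rewrite -[in X in _ -> _ -> _ -> X](@omega_power_shift (b + t0 - wlen v)).
    by rewrite !subrK; apply=> //; rewrite dsum_leBl -mulrSr.
  by rewrite addrAC dsum_addr_gt0 ?t0_gt0.
move: pb; rewrite eq_bv omega_power_low // addrC omega_power_shift ?t0_gt0 //.
by rewrite omega_power_low ?t0_le //; apply: cyc_v.
Qed.

Lemma bounded_t0 b : bounded (wlen v) (b + t0) <-> bounded (wlen v) b.
Proof.
split=> [|bd]; first by apply: bounded_le; rewrite ltW // dsum_ltDr t0_gt0.
by apply: boundedD => //; exists 1%N; rewrite t0_le.
Qed.

(** Consecutive positions are both bounded or both unbounded, so the seam
    between the two halves is invisible to them. *)
Lemma mirror_reduced : freely_reduced mirror.
Proof.
move=> b a /=; rewrite /mirror_fun.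
have -> : `[< bounded (wlen v) (b + t0) >] = `[< bounded (wlen v) b >].
  by apply: asbool_equiv_eq; apply: bounded_t0.
case: asboolP => [_|unb]; first exact: omega_power_reduced.
have -> : L + t0 - b = L + t0 - (b + t0) + t0 by rewrite opprD addrA subrK.
case eq_c: (omega_power (_ + t0)) => [c|] //= /Some_inj <-.
case eq_e: (omega_power (_ - _)) => [e|] //= /Some_inj.
rewrite letterVK => def_c; apply: (omega_power_reduced eq_e).
by rewrite eq_c def_c.
Qed.

End Length.

Lemma reflection_shift (L : A) :
    (forall b, bounded (wlen v) (L + t0 - b) <-> ~ bounded (wlen v) b) ->
  forall b, bounded (wlen v) (L + wlen v + t0 - b) <-> ~ bounded (wlen v) b.
Proof.
move=> Lrefl b; rewrite -Lrefl -(boundedDr (L + t0 - b) v_gt0).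
by rewrite -!addrA [wlen v + _]addrC -!addrA.
Qed.

(** On bounded positions, one more copy of [v] in front of v v v ... changes
    nothing. The unbounded positions are read backwards from the end, which the
    prefix moves along by [wlen v]. *)
Lemma mulg_mirror (L : A) Lrefl Lrefl' :
  (v * @mirror L Lrefl)%g = @mirror (L + wlen v) Lrefl'.
Proof.
apply: word_ext => [|b]; first by rewrite wlenM /= addrC.
rewrite wfunM /= /mirror_fun; case: leP => [le_bv|lt_vb].
  by rewrite asboolT ?omega_power_low //; exists 1%N.
have b'_gt0 : 0 < b - wlen v by rewrite dsum_ltBr add0r.
have -> : `[< bounded (wlen v) (b - wlen v) >] = `[< bounded (wlen v) b >].
  by apply: asbool_equiv_eq; rewrite -(boundedDr _ v_gt0) subrK.
rewrite -(omega_power_shift b'_gt0) subrK; case: asboolP => // _.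
by rewrite opprB addrA [L + t0 + _]addrAC.
Qed.

End Mirror.

(** * Products of involutions *)

Section Generation.
Variables (d : Order.disp_t) (Omega : bOrderType d).
Variables (G : groupType) (Sigma : {pred G}).
Local Notation A := (dsum Omega).
Local Notation t0 := (t0 Omega).
Local Notation letter := (letter Sigma).
Local Notation W := (word Omega Sigma).

Hypothesis Omega_limit : forall i : Omega, exists j : Omega, is_succ i j.
Hypothesis G_free : free_basis Sigma.

(** The letters [a], [b] and [a^-1] are pairwise distinct, as the inverse of a
    basis element is not in the basis, so one of them differs from both [c1] and
    [c2]. *)
Lemma letter_avoid2 (a b : G) (c1 c2 : letter) :
  a \in Sigma -> b \in Sigma -> a <> b -> exists c, c <> c1 /\ c <> c2.
Proof.
move=> Sa Sb neq_ab.
have La : (a \in Sigma) || ((a^-1)%g \in Sigma) by rewrite Sa.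
have Lb : (b \in Sigma) || ((b^-1)%g \in Sigma) by rewrite Sb.
pose la : letter := exist _ a La; pose lb : letter := exist _ b Lb.
have n_ab : la <> lb by move=> /(congr1 val).
have n_aV : la <> letterV la by apply: letterV_neq.
have n_bV : lb <> letterV la.
  move=> /(congr1 val)/= eq_b; move: (free_basisV G_free Sa).
  by rewrite -eq_b Sb.
case: (eqVneq la c1) (eqVneq la c2) (eqVneq lb c1) (eqVneq lb c2) =>
  [a1|/eqP a1] [a2|/eqP a2] [b1|/eqP b1] [b2|/eqP b2];
  try (by exists la); try (by exists lb); exists (letterV la); split; congruence.
Qed.

Variable T : {pred EAG Omega Sigma}.
Hypothesis T_group : group_closed T.
Hypothesis T_order2 : forall x, has_order x 2 -> x \in T.

(** The preimage in the monoid of words of the image of [T] in the quotient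
    monoid. Working with it avoids building an element of E(A, G) for each word
    that occurs. *)
Definition gen_class : {pred W} :=
  [pred w | `[< exists2 m, m \in T & Eval m = Mclass w >]].

Lemma gen_class1 : 1%g \in gen_class.
Proof. by apply/asboolP; exists 1%g; first exact: T_group.1. Qed.

Lemma gen_classM : mulg_closed gen_class.
Proof.
move=> x y /asboolP[m Tm eq_m] /asboolP[n Tn eq_n]; apply/asboolP.
exists (m * n)%g; first exact: (group_closedM T_group).
by rewrite -MclassM -eq_m -eq_n.
Qed.

Lemma Mclass_mulgK (x w : W) :
  G_reduced w -> Mclass (x * w * w^-1)%g = Mclass x.
Proof.
move=> red_w; rewrite -(mulgA x) -[RHS](congr1 (@Mclass _ _ _ _) (mulg1 x)).
apply/MclassP/Mcongr_mul; first exact: Mcongr_refl.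
by apply/MclassP; rewrite -[RHS](MclassV red_w) gmulfM.
Qed.

(** The square of the class is 1; if the class itself is 1 it does not have
    order 2, but it belongs to [T] as the neutral element. *)
Lemma gen_class_palindrome (w : W) :
  G_reduced w -> (w^-1)%g = w -> w \in gen_class.
Proof.
move=> red_w wV.
have Ew : Mclass w \in @EAG_pred _ Omega G Sigma.
  by apply/EAG_predP; exists w => //; apply: Rstar_reduced.
apply/asboolP; exists (InEAG Ew) => //.
have sqr1 : (InEAG Ew * InEAG Ew = 1)%g.
  by apply: val_inj; rewrite gmulfM /= -[X in (_ * Mclass X)%g]wV MclassV.
have [->|neq1] := EM (InEAG Ew = 1%g); first exact: T_group.1.
by apply: T_order2; split=> // [[|[|m]]].
Qed.

Lemma gen_class_congr (x y : W) :
  Mclass x = Mclass y -> x \in gen_class -> y \in gen_class.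
Proof.
by move=> eq_xy /asboolP[m Tm def_m]; apply/asboolP; exists m; rewrite -?eq_xy.
Qed.

(** With [z] the mirror word, [v = (v * z) * z] in the quotient, and [v * z] is
    a mirror word as well. *)
Lemma gen_class_cyclic (v : W) : 0 < wlen v -> freely_reduced v ->
    (forall a, v (wlen v) = Some a -> v t0 <> Some (letterV a)) ->
  v \in gen_class.
Proof.
move=> v_gt0 red_v cyc_v.
have [e /(exists_reflection v_gt0) Lrefl] := Omega_limit (lead (wlen v)).
set L := tgen e in Lrefl; have Lrefl' := reflection_shift v_gt0 Lrefl.
pose z := mirror Lrefl.
have red L' (Lr : forall b,
      bounded (wlen v) (L' + t0 - b) <-> ~ bounded (wlen v) b) :
    G_reduced (mirror Lr).
  by apply: freely_reduced_G => //; apply: mirror_reduced.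
have Tz : z \in gen_class by apply: gen_class_palindrome (red _ _) (mirrorV _).
apply: (@gen_class_congr ((v * z) * z)%g).
  by rewrite -{2}[z]mirrorV Mclass_mulgK //; apply: red.
apply: gen_classM => //; rewrite /z (mulg_mirror v_gt0 Lrefl Lrefl').
exact: gen_class_palindrome (red _ _) (mirrorV _).
Qed.

Lemma gen_class_letter (c : letter) : wletter Omega c \in gen_class.
Proof.
have nc := letterV_neq G_free (a := c).
apply: gen_class_cyclic; first exact: t0_gt0.
  exact: freely_reduced_letter.
by move=> a /=; rewrite eqxx => -[<-] [].
Qed.

Hypothesis Sigma_ge2 : exists a b : G, [/\ a \in Sigma, b \in Sigma & a <> b].

Lemma gen_class_reduced (u : W) : G_reduced u -> u \in gen_class.
Proof.
move=> red_u; have fred_u := G_reduced_freely red_u.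
have := wlen_ge0 u; rewrite le_eqVlt => /predU1P[u0|u_gt0].
  suff -> : u = 1%g by apply: gen_class1.
  have out (w : W) b : wlen w = 0 -> w b = None.
    move=> w0; apply: wfun_out; rewrite w0 t0_le.
    by apply/negP => /andP[/lt_le_trans lt0 /lt0]; rewrite ltxx.
  by apply: word_ext => [|b]; rewrite -?u0 // !out.
have [f uf] : exists a, u t0 = Some a by apply: wfun_ex; rewrite ?t0_gt0 ?t0_le.
have [l ul] : exists a, u (wlen u) = Some a by apply: wfun_ex.
have [a [b [Sa Sb neq_ab]]] := Sigma_ge2.
have [c [nc_f nc_l]] := letter_avoid2 (letterV f) (letterV l) Sa Sb neq_ab.
have red_c : freely_reduced (wletter Omega c).
  exact/freely_reduced_letter/letterV_neq.
apply: (@gen_class_congr (u * wletter Omega c * wletter Omega (letterV c))%g).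
  by rewrite -wletterV Mclass_mulgK //; apply: freely_reduced_G.
apply: gen_classM (gen_class_letter _); apply: gen_class_cyclic.
- by rewrite wlenM dsum_addr_gt0 ?t0_gt0.
- by apply: freely_reducedM => // x; rewrite ul /= eqxx => /Some_inj <- /Some_inj/nc_l.
move=> x; rewrite wlenM addrC wfunMr ?t0_gt0 //= eqxx => /Some_inj <-.
by rewrite t0_le u_gt0 uf => /Some_inj def_f; case: nc_f; rewrite def_f letterVK.
Qed.

End Generation.

Theorem proposition6p1
  (d : Order.disp_t) (Omega : bOrderType d)
  (Omega_wo : well_order (<=%O : rel Omega))
  (Omega_limit : forall i : Omega, exists j : Omega, is_succ i j)
  (G : groupType) (Sigma : {pred G})
  (G_free : free_basis Sigma)
  (Sigma_ge2 : exists a b : G, [/\ a \in Sigma, b \in Sigma & a <> b]) :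
  generated_by (fun x : EAG Omega Sigma => has_order x 2).
Proof.
move=> x T T_group T_order2.
case/EAG_predP: (EvalP x) => w Rw def_x.
have /asboolP[m Tm def_m] : w \in gen_class T.
  apply: Rw; first by split; [exact: gen_class1 | exact: gen_classM].
  exact: gen_class_reduced.
by have <- : m = x by apply: val_inj; rewrite /= def_x.
Qed.
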